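(* Let $X$ be a connected vertex-transitive graph of order $10p$, where $p\geq 7$ is a prime. Let $G$ be a minimal transitive subgroup of $\mathrm{Aut}(X)$ and suppose $G$ has a nontrivial normal subgroup $N$ whose orbits form a complete block system of $G$ with blocks of size $10$. Then $X$ contains a Hamilton cycle.
   Context: A transitive subgroup $G$ of $\mathrm{Aut}(X)$ is minimal transitive if no proper subgroup of $G$ is transitive on $V(X)$. *)

(* Defs.v *)
From mathcomp Require Import all_boot all_fingroup.
Set Implicit Arguments. Unset Strict Implicit. Unset Printing Implicit Defensive.
Import GroupScope.

Definition simple_graph (V : finType) (e : rel V) : Prop :=
  symmetric e /\ irreflexive e.

Definition connected_graph (V : finType) (e : rel V) : Prop :=
  forall x y : V, connect e x y.

Definition Aut_graph (V : finType) (e : rel V) : {set {perm V}} :=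
  [set g : {perm V} | [forall x, forall y, e (g x) (g y) == e x y]].

Lemma Aut_graph_group_set (V : finType) (e : rel V) : group_set (Aut_graph e).
Proof.
apply/group_setP; split.
  by rewrite inE; apply/forallP=> x; apply/forallP=> y; rewrite !perm1.
move=> g h; rewrite !inE => /forallP Hg /forallP Hh.
apply/forallP=> x; apply/forallP=> y; rewrite !permM.
by rewrite (eqP (forallP (Hh (g x)) (g y))) (eqP (forallP (Hg x) y)).
Qed.

Canonical Aut_graph_group (V : finType) (e : rel V) :=
  Group (Aut_graph_group_set e).

Definition vertex_transitive (V : finType) (e : rel V) : Prop :=
  [transitive Aut_graph e, on [set: V] | 'P].

Definition minimal_transitive (V : finType) (e : rel V) (G : {group {perm V}}) : Prop :=
  [/\ G \subset Aut_graph e,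
      [transitive G, on [set: V] | 'P] &
      forall H : {group {perm V}}, H \proper G -> ~ [transitive H, on [set: V] | 'P]].

Definition hamiltonian (V : finType) (e : rel V) : Prop :=
  exists c : seq V, [/\ uniq c, size c = #|V| & path.cycle e c].

(* Main.v *)
Require Import Defs.
From mathcomp Require Import all_boot all_fingroup all_algebra all_solvable.
From mathcomp Require Import zify ring.
Set Implicit Arguments. Unset Strict Implicit. Unset Printing Implicit Defensive.

(** Let S be a Sylow 5-subgroup of N. Its orbits have size 5, and by the
    Frattini argument some element g of G of p-power order normalises S and
    permutes the p orbits of N cyclically; then g^p = 1. Two S-orbits either
    have the same kernel in S or are joined completely or not at all, and as a
    p-element acts trivially on a quotient of S of order 5, one can choose
    coordinates (s, i, x) in {U, W} x F_p x F_5 on the vertices for which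
    adjacency depends only on s, s', i' - i and x' - x: the graph is a
    bicirculant. An element of N exchanging two S-orbits in a block preserves
    i, which forces the U-U and W-W valencies of every i-difference to agree,
    and likewise the U-W and W-U valencies.

    Let T be the set of U-W differences. If two elements of T differ in both
    coordinates, their difference generates F_p x F_5 and alternating between
    them gives a Hamilton cycle. Otherwise T lies on a line, and one lifts a
    Hamilton cycle of the quotient of order 2p or 10 along a translation; when
    the S-orbits contain 5-cycles, one instead runs through each of them
    entirely, choosing directions so that the walk closes up. The remaining
    possibilities are a prism over a cycle of length 5p, configurations where
    the centraliser of a matching excludes the element of N, and disconnected
    graphs. *)

(** * Hamilton cycles from enumerations *)

(** An enumeration by [#|T|] indices that is onto is automatically injective, so distinctness of the
    vertices comes for free. *)
Lemma ham_seq (T : finType) (E : rel T) (f : nat -> T) :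
  0 < #|T| -> (forall k, k.+1 < #|T| -> E (f k) (f k.+1)) ->
  E (f #|T|.-1) (f 0) -> (forall w, exists2 k, k < #|T| & w = f k) ->
  hamiltonian E.
Proof.
move=> T0 Estep Ewrap fsurj.
exists (mkseq f #|T|); split; last 1 first.
- case: #|T| T0 Estep Ewrap => // n _ Estep Ewrap.
  rewrite /mkseq /= rcons_path; apply/andP; split.
    apply/(pathP (f 0)) => i; rewrite size_map size_iota => ltin.
    rewrite (nth_map 0) ?size_iota // nth_iota // add1n.
    rewrite -[f 0 :: _]/(mkseq f n.+1) nth_mkseq ?Estep //.
    exact: leqW.
  case: n Estep Ewrap => [//|n] _.
  have -> : iota 1 n.+1 = iota 1 n ++ [:: n.+1] by rewrite -{1}[n.+1]addn1 iotaD add1n.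
  by rewrite map_cat last_cat.
- apply/card_uniqP; rewrite size_mkseq; apply: eq_card => w.
  have [k ltk ->] := fsurj w; rewrite inE.
  by apply/mapP; exists k => //; rewrite mem_iota add0n.
- by rewrite size_mkseq.
Qed.

(** The [m] rows of length [r] are concatenated: index [k] stands for row [k %/ r], position
    [k %% r]. *)
Lemma ham_rows (T : finType) (E : rel T) (F : nat -> nat -> T) (m r : nat) :
  0 < m -> 0 < r -> m * r = #|T| ->
  (forall j k, j < m -> k.+1 < r -> E (F j k) (F j k.+1)) ->
  (forall j, j.+1 < m -> E (F j r.-1) (F j.+1 0)) ->
  E (F m.-1 r.-1) (F 0 0) ->
  (forall w, exists j k, [/\ j < m, k < r & w = F j k]) ->
  hamiltonian E.
Proof.
case: m => // m _; case: r => // r _ cardT Erow Enext Ewrap Fsurj.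
apply: (@ham_seq _ _ (fun k => F (k %/ r.+1) (k %% r.+1))); rewrite -cardT //.
- move=> k ltk; have ltkm : k %/ r.+1 < m.+1 by rewrite ltn_divLR // ltnW.
  have := ltn_pmod k (isT : 0 < r.+1); rewrite ltnS leq_eqVlt => /orP[/eqP kr|kr].
    have -> : k.+1 = (k %/ r.+1).+1 * r.+1 by rewrite {1}(divn_eq k r.+1) kr mulSn; lia.
    rewrite mulnK // modnMl kr; apply: (Enext).
    move: ltk; rewrite {1}(divn_eq k r.+1) kr -addnS -mulSnr ltn_mul2r; lia.
  have -> : k.+1 = k %/ r.+1 * r.+1 + (k %% r.+1).+1 by rewrite {1}(divn_eq k r.+1) addnS.
  rewrite divnMDl // modnMDl !(divn_small (m := (_ %% _).+1)) // (modn_small (m := (_ %% _).+1)) //.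
  by rewrite addn0; apply: Erow.
- have -> : (m.+1 * r.+1).-1 = m * r.+1 + r by lia.
  by rewrite divnMDl // modnMDl divn_small // modn_small // addn0 div0n mod0n.
- move=> w; have [j [k [ltj ltk ->]]] := Fsurj w.
  exists (j * r.+1 + k); last by rewrite divnMDl // modnMDl divn_small // modn_small // addn0.
  by apply: (@leq_trans (j.+1 * r.+1)); [lia | rewrite leq_mul2r ltj orbT].
Qed.
(** Makes Hamiltonicity decidable, so that [bicirc_hamiltonian] can argue by contradiction. *)
Lemma hamiltonianP (T : finType) (E : rel T) :
  reflect (hamiltonian E) [exists c : #|T|.-tuple T, uniq c && path.cycle E c].
Proof.
apply: (iffP existsP) => [[c /andP[uc cc]]|[c [uc sc cc]]].
  by exists c; rewrite size_tuple.
by exists (tcast sc (in_tuple c)); rewrite val_tcast uc.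
Qed.

Lemma hamiltonian_bij (T V : finType) (E : rel T) (e : rel V) (f : T -> V) :
  injective f -> #|T| = #|V| -> (forall x y, e (f x) (f y) = E x y) ->
  hamiltonian E -> hamiltonian e.
Proof.
move=> f_inj cTV fE [c [uc sc cc]]; exists (map f c); split.
- by rewrite map_inj_uniq.
- by rewrite size_map sc.
- by rewrite cycle_map (eq_cycle (e' := E)).
Qed.

Lemma connected_graph_bij (T V : finType) (E : rel T) (e : rel V) (f : T -> V) :
  bijective f -> (forall x y, e (f x) (f y) = E x y) ->
  connected_graph e -> connected_graph E.
Proof.
case=> f' fK f'K fE con x y; have /connectP[c cP cL] := con (f x) (f y).
apply/connectP; exists (map f' c).
  by rewrite -(eq_path (e := relpre f e)) // -path_map (mapK f'K).
by rewrite -[x]fK last_map -cL fK.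
Qed.

(** * Arithmetic of prime fields *)

Section PrimeField.
Import GRing.Theory.
Local Open Scope ring_scope.
Variables (q : nat) (q_pr : prime q).

Lemma Fp_natP (a : 'F_q) : exists2 k : nat, (k < q)%N & a = k%:R.
Proof.
exists (nat_of_ord a); last by rewrite natr_Zp.
by rewrite -[X in (_ < X)%N](Fp_cast q_pr) ltn_ord.
Qed.

Lemma Fp_natr_eq0 (k : nat) : (k%:R == 0 :> 'F_q) = (q %| k)%N.
Proof. by rewrite (dvdn_pcharf (pchar_Fp q_pr)). Qed.

Lemma Fp_charr : q%:R = 0 :> 'F_q.
Proof. by apply/eqP; rewrite Fp_natr_eq0. Qed.

Lemma Fp_multP (d a : 'F_q) : d != 0 -> exists2 k : nat, (k < q)%N & a = k%:R * d.
Proof.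
move=> d0; have [k kq kE] := Fp_natP (a / d); exists k => //.
by rewrite -kE divfK.
Qed.

Lemma Fp_natr_mod k : (k %% q)%:R = k%:R :> 'F_q.
Proof.
by rewrite [in RHS](divn_eq k q) natrD natrM Fp_charr mulr0 add0r.
Qed.

End PrimeField.

(** With both coordinates nonzero, [(d, s)] generates the product group, which is cyclic of order
    [p * q]. *)
Lemma Fp_chinese (p q : nat) (p_pr : prime p) (q_pr : prime q)
    (d a : 'F_p) (s b : 'F_q) : p != q -> d != 0%R -> s != 0%R ->
  exists k, [/\ k < p * q, a = (k%:R * d)%R & b = (k%:R * s)%R].
Proof.
move=> pq d0 s0; have [i _ ->] := Fp_multP p_pr a d0.
have [j _ ->] := Fp_multP q_pr b s0.
have co : coprime p q by rewrite prime_coprime // dvdn_prime2.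
exists (chinese p q i j %% (p * q)); split.
- by rewrite ltn_mod muln_gt0 !prime_gt0.
- congr (_ * _)%R; rewrite -(Fp_natr_mod p_pr (_ %% _)) modn_dvdm ?dvdn_mulr //.
  by rewrite chinese_modl // Fp_natr_mod.
- congr (_ * _)%R; rewrite -(Fp_natr_mod q_pr (_ %% _)) modn_dvdm ?dvdn_mull //.
  by rewrite chinese_modr // Fp_natr_mod.
Qed.

(** * Signed sums in F_5 *)

Definition all_F5 : seq 'F_5 := [:: 0; 1; 2%:R; 3%:R; 4%:R]%R.

Lemma mem_all_F5 (x : 'F_5) : x \in all_F5.
Proof. by case: x => [[|[|[|[|[|?]]]]] ?]. Qed.

(** Each nonzero term with a free sign enlarges the set of attainable sums until it is all of F_5,
    and four terms suffice; the finitely many cases are checked by computation. *)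
Lemma four_signs (c1 c2 c3 c4 v : 'F_5) :
  (c1 != 0 -> c2 != 0 -> c3 != 0 -> c4 != 0 ->
   exists s : seq bool,
     (if nth false s 0 then - c1 else c1) + (if nth false s 1 then - c2 else c2)
     + (if nth false s 2 then - c3 else c3) + (if nth false s 3 then - c4 else c4)
     = v)%R.
Proof.
pose B := [:: false; true].
pose sg (b : bool) (c : 'F_5) := (if b then - c else c)%R.
pose Q c1 c2 c3 c4 v := has (fun b1 => has (fun b2 => has (fun b3 => has (fun b4 =>
   (sg b1 c1 + sg b2 c2 + sg b3 c3 + sg b4 c4 == v)%R) B) B) B) B.
have H : all (fun c1 => all (fun c2 => all (fun c3 => all (fun c4 => all (fun v =>
   [|| c1 == 0%R, c2 == 0%R, c3 == 0%R, c4 == 0%R | Q c1 c2 c3 c4 v])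
    all_F5) all_F5) all_F5) all_F5) all_F5.
  by vm_compute.
move=> n1 n2 n3 n4.
have := allP H _ (mem_all_F5 c1) => /allP/(_ _ (mem_all_F5 c2))/allP/(_ _ (mem_all_F5 c3)).
move=> /allP/(_ _ (mem_all_F5 c4))/allP/(_ _ (mem_all_F5 v)).
rewrite (negPf n1) (negPf n2) (negPf n3) (negPf n4) /=.
case/hasP=> b1 _ /hasP[b2 _ /hasP[b3 _ /hasP[b4 _ /eqP E]]].
by exists [:: b1; b2; b3; b4].
Qed.

Lemma signed_sum (m : nat) (c : nat -> 'F_5) (v : 'F_5) : 4 <= m ->
  (forall l, c l != 0%R) ->
  exists s : nat -> 'F_5, (forall l, s l = c l \/ s l = (- c l)%R) /\
    (\sum_(0 <= l < m) s l)%R = v.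
Proof.
(* The terms from index 4 on keep their sign; the first four must then sum to [w]. *)
move=> m4 c0; pose w := (v - \sum_(4 <= l < m) c l)%R.
have [b bE] := four_signs w (c0 0) (c0 1) (c0 2) (c0 3).
exists (fun l => if nth false b l && (l < 4) then (- c l)%R else c l); split.
  by move=> l; case: ifP => _; [right|left].
rewrite (big_cat_nat (n := 4)) //= [X in (_ + X)%R](eq_big_nat _ _ (F2 := c)); last first.
  by move=> l /andP[l4 _]; rewrite ltnNge l4 andbF.
rewrite !big_nat_recr // big_geq //= !andbT GRing.add0r.
by rewrite bE /w GRing.subrK.
Qed.

(** * Bicirculants over F_p x F_5 *)

(** Shields [lia] from facts about finite fields, keeping only natural variables, equations,
    inequalities and parities. *)
Ltac nat_lia := repeat match goal with
  | H : ?T |- _ => lazymatch T with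
    | is_true (leq _ _) => fail
    | is_true (odd _) => fail
    | nat => fail
    | @eq nat _ _ => fail
    | _ => clear H
    end
  end; lia.

Section Bicirculant.
Import GRing.Theory.
Local Open Scope ring_scope.
Variable p : nat.

(** The factors select one of the two S-orbits of a block, the block, and the point of the
    S-orbit. *)
Definition bivertex : finType := (bool * 'F_p * 'F_5)%type.

Definition vtx (s : bool) (i : 'F_p) (x : 'F_5) : bivertex := (s, i, x).

(* [s = false] is the side called U above, [s = true] the side W. *)
Definition bicirc (C : bool -> bool -> 'F_p -> 'F_5 -> bool) : rel bivertex :=
  fun u w => C u.1.1 w.1.1 (w.1.2 - u.1.2) (w.2 - u.2).

Definition shift (a : 'F_p) (b : 'F_5) (u : bivertex) : bivertex :=
  vtx u.1.1 (u.1.2 + a) (u.2 + b).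

Hypotheses (p_pr : prime p) (p7 : (7 <= p)%N).
Variable C : bool -> bool -> 'F_p -> 'F_5 -> bool.
Hypothesis Csym : forall s t d x, C s t d x = C t s (- d) (- x).
Local Notation E := (bicirc C).
Let F5 : prime 5 := isT.

Lemma card_bivertex : #|bivertex| = (10 * p)%N.
Proof. by rewrite !card_prod card_bool !card_Fp //; nat_lia. Qed.

Lemma bicircE s t i j x y : E (vtx s i x) (vtx t j y) = C s t (j - i) (y - x).
Proof. by []. Qed.

(** * Translations and the lifting of Hamilton paths *)

Lemma bicirc_shift a b u w : E (shift a b u) (shift a b w) = E u w.
Proof. by rewrite /bicirc /=; congr C; ring. Qed.

Lemma bicirc_sub s t i j x y : C s t i x -> j = i -> y = x -> C s t j y.
Proof. by move=> + -> ->. Qed.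

Lemma bicirc_subN s t i j x y : C s t i x -> j = - i -> y = - x -> C t s j y.
Proof. by rewrite Csym => + -> ->. Qed.

(** The path [f] meets every orbit of the translation by [(a, b)] and ends next to the translate of
    its start, so its [q] translates join up to a cycle. *)
Lemma ham_lift (f : nat -> bivertex) (m q : nat) (a : 'F_p) (b : 'F_5) :
  (0 < m)%N -> (0 < q)%N -> (q * m = 10 * p)%N ->
  q%:R * a = 0 -> q%:R * b = 0 ->
  (forall k, (k.+1 < m)%N -> E (f k) (f k.+1)) ->
  E (f m.-1) (shift a b (f 0%N)) ->
  (forall w, exists j k, [/\ (j < q)%N, (k < m)%N & w = shift (j%:R * a) (j%:R * b) (f k)]) ->
  hamiltonian E.
Proof.
move=> m0 q0 qm qa qb step wrap surj.
apply: (@ham_rows _ _ (fun j k => shift (j%:R * a) (j%:R * b) (f k)) q m) => //.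
- by rewrite qm card_bivertex.
- by move=> j k _ km; rewrite bicirc_shift step.
- move=> j _; rewrite -(bicirc_shift (j%:R * a) (j%:R * b)) in wrap.
  move: wrap; congr (is_true (E _ _)).
  by rewrite /shift -natr1 /=; congr vtx; ring.
(* As [q] times [(a, b)] vanishes, the start is the translate by [q.-1] times [(a, b)] of its own
   translate by [(a, b)]. *)
- have -> : shift (0%:R * a) (0%:R * b) (f 0%N) =
    shift (q.-1%:R * a) (q.-1%:R * b) (shift a b (f 0%N)).
    have pred (R : pzRingType) (c : R) : q%:R * c = 0 -> c + q.-1%:R * c = 0.
      by move=> <-; rewrite -{2}(prednK q0) -natr1 mulrDl mul1r addrC.
    by rewrite /shift /= -!addrA !pred // !mul0r.
  by rewrite bicirc_shift.
Qed.

(** For a translation within F_5 the path only has to cover the quotient of order [2 * p], since the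
    multiples of [b] exhaust F_5. *)
Lemma ham_lift5 (f : nat -> bivertex) (b : 'F_5) : b != 0 ->
  (forall k, (k.+1 < 2 * p)%N -> E (f k) (f k.+1)) ->
  E (f (2 * p).-1) (shift 0 b (f 0%N)) ->
  (forall s i, exists2 k, (k < 2 * p)%N & (f k).1 = (s, i)) ->
  hamiltonian E.
Proof.
move=> b0 step wrap surj; have p0 := prime_gt0 p_pr.
apply: (@ham_lift f (2 * p) 5 0 b) => //; first by nat_lia.
- by nat_lia.
- by rewrite mulr0.
- by rewrite (Fp_charr F5) mul0r.
move=> [[s i] x]; have [k km fk] := surj s i.
have [j j5 jE] := Fp_multP F5 (x - (f k).2) b0.
exists j, k; split=> //; rewrite /shift fk /= mulr0 addr0 -jE /vtx.
by congr (_, _, _); ring.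
Qed.

Lemma connected_const (Q : eqType) (phi : bivertex -> Q) : connected_graph E ->
  (forall u w, E u w -> phi u = phi w) -> forall u w, phi u = phi w.
Proof.
move=> con inv u w; have /connectP[c cP ->] := con u w.
by elim: c u cP => //= v c IH u /andP[/inv -> /IH].
Qed.

(** Using the two differences alternately gives displacement [(d - d', x - x')] every two steps, a
    generator of F_p x F_5. *)
Lemma ham_haar (d d' : 'F_p) (x x' : 'F_5) : d != d' -> x != x' ->
  C false true d x -> C false true d' x' -> hamiltonian E.
Proof.
move=> dd xx H H'.
have p5 : p != 5 by nat_lia.
have [D0 X0] : d - d' != 0 /\ x - x' != 0 by rewrite !subr_eq0.
apply: (@ham_lift (fun k => if k is 0%N then vtx false 0 0 else vtx true d x) 2 (p * 5)
   (d - d') (x - x')) => //; first by nat_lia.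
- by nat_lia.
- by rewrite natrM (Fp_charr p_pr) !mul0r.
- by rewrite natrM (Fp_charr F5) mulr0 mul0r.
- by case=> // _; rewrite bicircE !subr0.
- rewrite /shift /= bicircE; apply: bicirc_subN H' _ _; ring.
move=> [[[] i] y].
  have [k [kp kE1 kE2]] := Fp_chinese p_pr F5 (i - d) (y - x) p5 D0 X0.
  by exists k, 1%N; split=> //; rewrite /shift /vtx /= -kE1 -kE2; congr (_, _, _); ring.
have [k [kp kE1 kE2]] := Fp_chinese p_pr F5 i y p5 D0 X0.
by exists k, 0%N; split=> //; rewrite /shift /vtx /= -kE1 -kE2; congr (_, _, _); ring.
Qed.

(** Steps [(d, x)] trace a cycle of length [5p] on each side; row 0 follows the one on U and row 1
    returns along W, whence the decreasing multiples there. *)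
Lemma ham_prism (d d' : 'F_p) (x x' : 'F_5) : d != 0 -> x != 0 ->
  C false false d x -> C true true d x -> C false true d' x' -> hamiltonian E.
Proof.
move=> d0 x0 HU HW HT; have p5 : p != 5 by nat_lia.
have p0 := prime_gt0 p_pr.
pose F j k := if j is 0%N then vtx false (k%:R * d) (k%:R * x) else
  vtx true ((p * 5 - k.+1)%:R * d + d') ((p * 5 - k.+1)%:R * x + x').
have dec k : (k.+1 < p * 5)%N -> (p * 5 - k.+1 = (p * 5 - k.+2).+1)%N by nat_lia.
apply: (@ham_rows _ _ F 2 (p * 5)) => //; first by nat_lia.
- by rewrite card_bivertex; nat_lia.
- case=> [|[|//]] k _ kp; rewrite bicircE.
    by apply: bicirc_sub HU _ _; rewrite -natr1; ring.
  by apply: bicirc_subN HW _ _; rewrite (dec _ kp) -natr1; ring.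
- case=> // _; rewrite bicircE subn1; apply: bicirc_sub HT _ _; ring.
- rewrite /F /= bicircE prednK ?muln_gt0 ?p0 // subnn.
  by apply: bicirc_subN HT _ _; ring.
move=> [[[] i] y].
  have [k [kp kE1 kE2]] := Fp_chinese p_pr F5 (i - d') (y - x') p5 d0 x0.
  exists 1%N, (p * 5 - k.+1)%N; split=> //; first by nat_lia.
  rewrite /F /=; have -> : (p * 5 - (p * 5 - k.+1).+1 = k)%N by nat_lia.
  by rewrite -kE1 -kE2 /vtx; congr (_, _, _); ring.
have [k [kp kE1 kE2]] := Fp_chinese p_pr F5 i y p5 d0 x0.
by exists 0%N, k; split=> //; rewrite /F /vtx -kE1 -kE2.
Qed.

Lemma F5_mul4 (x : 'F_5) : 4%:R * x = - x.
Proof.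
by apply/eqP; rewrite -subr_eq0 opprK -[x in _ + x]mul1r -mulrDl natr1 (Fp_charr F5) mul0r.
Qed.

(* The quotient by translations of order [p] is a pentagonal prism; the cycle
   U_0 ... U_4 W_4 ... W_0 has displacement [8 d]. *)
Lemma ham_twisted_prism (d d' : 'F_p) (x x' : 'F_5) : d != 0 -> x != 0 ->
  C false false d x -> C true true d (- x) -> C false true d' x' -> hamiltonian E.
Proof.
move=> d0 x0 HU HW HT; have p0 := prime_gt0 p_pr.
(* The prime [p] exceeds 2, so it does not divide 8. *)
have d80 : 8%:R * d != 0.
  rewrite mulf_neq0 // Fp_natr_eq0 // (_ : 8 = 2 ^ 3)%N // Euclid_dvdX //=.
  by rewrite andbT; apply/negP => /dvdn_leq; nat_lia.
pose f k := if (k < 5)%N then vtx false (k%:R * d) (k%:R * x) else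
  vtx true (4%:R * d + (k - 5)%:R * d + d') (4%:R * x - (k - 5)%:R * x + x').
apply: (@ham_lift f 10 p (8%:R * d) 0) => //; first by nat_lia.
- by rewrite (Fp_charr p_pr) mul0r.
- by rewrite mulr0.
- move=> k k10; rewrite /f; case: (ltngtP k.+1 5) => k5.
  + rewrite bicircE; apply: bicirc_sub HU _ _; rewrite -natr1; ring.
  + rewrite bicircE subSn -1?ltnS //.
    by apply: bicirc_sub HW _ _; rewrite -natr1; ring.
  + by case: k5 => -> /=; rewrite bicircE subnn; apply: bicirc_sub HT _ _; ring.
- by rewrite /f /shift /= bicircE -[(9 - 5)%N]/4%N; apply: (bicirc_subN HT) _ _; ring.
move=> [[[] i] y].
  have [k kp kE1] := Fp_multP F5 (4%:R * x + x' - y) x0.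
  have [j jp jE1] := Fp_multP p_pr (i - (4%:R * d + k%:R * d + d')) d80.
  exists j, (k + 5)%N; split=> //; first by nat_lia.
  rewrite /f ltnNge leq_addl /= addnK /shift /= -jE1 -kE1 /vtx.
  by congr (_, _, _); ring.
have [k kp kE1] := Fp_multP F5 y x0.
have [j jp jE1] := Fp_multP p_pr (i - k%:R * d) d80.
exists j, k; split=> //; first exact: ltn_trans kp _.
by rewrite /f kp /shift /= -jE1 -kE1 /vtx; congr (_, _, _); ring.
Qed.

(* The path U_0 ... U_(p-1) W_(p-1) ... W_0 in the quotient of order 2p; two
   distinct choices of [x1] or of [z1] give distinct displacements. *)
Lemma ham_double_path (d d' : 'F_p) (x x1 y z z1 : 'F_5) : d != 0 ->
  C false false d x -> C false false d x1 -> C true true d y ->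
  C false true d' z -> C false true d' z1 ->
  (p - 2)%:R * x + x1 + z1 - (p - 1)%:R * y - z != 0 -> hamiltonian E.
Proof.
move=> d0 HU HU1 HW HT HT1 v0.
(* The last of the [p - 1] steps along U uses [x1] and the crossing to W uses [z1]; the walk back
   uses [y] and closes with [z]. *)
pose f k := if (k < p.-1)%N then vtx false (k%:R * d) (k%:R * x) else
  if (k < p)%N then vtx false ((p - 1)%:R * d) ((p - 2)%:R * x + x1) else
  vtx true ((2 * p - k.+1)%:R * d + d') ((p - 2)%:R * x + x1 + z1 - (k - p)%:R * y).
apply: (@ham_lift5 f _ v0) => //.
- move=> k kp; rewrite /f.
  case: (ltnP k.+1 p.-1) => k1.
    rewrite (ltn_trans _ k1) // bicircE; apply: bicirc_sub HU _ _; rewrite -natr1; ring.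
  case: (ltnP k.+1 p) => k2.
    have [k3 -> ->] : [/\ (k < p.-1)%N, p - 1 = k.+1 & p - 2 = k]%N by split; nat_lia.
    rewrite k3 bicircE; apply: bicirc_sub HU1 _ _; rewrite -?natr1; ring.
  rewrite ltnNge (_ : (p.-1 <= k)%N) /=; last by nat_lia.
  case: (ltnP k p) => k3.
    have [-> ->] : (2 * p - k.+2 = p - 1 /\ k.+1 - p = 0)%N by split; nat_lia.
    by rewrite bicircE; apply: bicirc_sub HT1 _ _; ring.
  have [-> ->] : (2 * p - k.+1 = (2 * p - k.+2).+1 /\ k.+1 - p = (k - p).+1)%N by split; nat_lia.
  by rewrite bicircE; apply: (bicirc_subN HW) _ _; rewrite -natr1; ring.
- rewrite /f (_ : (0 < p.-1)%N); last by nat_lia.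
  rewrite ltnNge (_ : (p.-1 <= _)%N) /=; last by nat_lia.
  rewrite ltnNge (_ : (p <= _)%N) /=; last by nat_lia.
  have [-> ->] : (2 * p - (2 * p).-1.+1 = 0 /\ (2 * p).-1 - p = p - 1)%N by split; nat_lia.
  by rewrite /shift /= bicircE; apply: (bicirc_subN HT) _ _; ring.
case=> i.
  have [k kp kE] := Fp_multP p_pr (i - d') d0.
  exists (2 * p - k.+1)%N; first by nat_lia.
  rewrite /f ltnNge (_ : (p.-1 <= _)%N) /=; last by nat_lia.
  rewrite ltnNge (_ : (p <= _)%N) /=; last by nat_lia.
  have -> : (2 * p - (2 * p - k.+1).+1 = k)%N by nat_lia.
  by rewrite -kE subrK.
have [k kp kE] := Fp_multP p_pr i d0.
exists k; first by nat_lia.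
rewrite /f; case: ltnP => k1; first by rewrite /= -kE.
by rewrite kp /= kE; congr (_, (_%:R * _)); nat_lia.
Qed.

(* A cycle winding twice around the quotient, straight at two steps and
   switching sides at all others; its displacement is [2 (x + y)]. *)
Lemma ham_wreath (d : 'F_p) (x y z : 'F_5) : d != 0 ->
  C false false d x -> C true true d y -> C false true d z -> C false true (- d) z ->
  x + y != 0 -> hamiltonian E.
Proof.
move=> d0 HU HW HT HT' v0.
have p_odd : odd p by case: (even_prime p_pr) => // p2; move: p7; rewrite p2.
have p1_even : odd p.-1 = false by rewrite -subn1 oddB ?prime_gt0 // p_odd.
have p1E : p.-1%:R + 1 = 0 :> 'F_p by rewrite natr1 prednK ?prime_gt0 // Fp_charr.
have v20 : 2%:R * (x + y) != 0 by rewrite mulf_neq0.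
(* The steps from 0 to 2 are straight, all later ones cross. With the step into the next lap, a lap
   has [p - 2] crossings, an odd number, so the second lap visits the opposite side at every
   index. *)
pose side k := odd k && (3 <= k)%N.
(* The offset [z] is absorbed into the W coordinate, so a crossing in either direction leaves [u]
   unchanged. *)
pose row (s : bool) (i : 'F_p) (u : 'F_5) := vtx s i (if s then u + z else u).
pose f k := if (k < p)%N then row (side k) (k%:R * d) ((minn k 2)%:R * x) else
  row (~~ side (k - p)%N) ((k - p)%:R * d) (2%:R * x + (minn (k - p) 2)%:R * y).
have cross s i j u v : j = i + d -> v = u -> E (row s i u) (row (~~ s) j v).
  move=> -> ->; rewrite /row; case: s; rewrite bicircE.
    by apply: (bicirc_subN HT') _ _ => //; ring.
  by apply: bicirc_sub HT _ _ => //; ring.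
have sideS k : (2 <= k)%N -> side k.+1 = ~~ side k.
  by rewrite /side => k2; case: k k2 => [|[|[|k]]] //= _; rewrite !andbT negbK.
have step s (a : 'F_5) (c : 'F_5) k : C s s d c -> (k.+1 < 3)%N || (2 <= k)%N ->
  E (row (s (+) side k) (k%:R * d) (a + (minn k 2)%:R * c))
    (row (s (+) side k.+1) (k.+1%:R * d) (a + (minn k.+1 2)%:R * c)).
  move=> Hc /orP[k3|k2].
    have [-> -> -> ->] : [/\ side k = false, side k.+1 = false, minn k 2 = k & minn k.+1 2 = k.+1].
      by rewrite /side; split; nat_lia.
    by rewrite /row addbF bicircE; apply: bicirc_sub Hc _ _; rewrite -natr1; case: (s); ring.
  rewrite sideS // addbN; apply: cross; first by rewrite -natr1; ring.
  by rewrite !(minn_idPr _) // leqW.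
have stepT k : (k.+1 < 3)%N || (2 <= k)%N by nat_lia.
apply: (@ham_lift5 f _ v20) => //.
- move=> k kp; rewrite /f.
  case: (ltnP k.+1 p) => k1.
    by rewrite (ltn_trans _ k1) //; have := step false 0 x k HU (stepT k); rewrite !add0r.
  case: (ltnP k p) => k2.
    have [-> kE] : (k.+1 - p = 0 /\ k = p.-1)%N by split; nat_lia.
    have -> : side 0 = side k.
      by rewrite /side kE p1_even.
    apply: cross; last by rewrite min0n mul0r addr0 (minn_idPr _) //; nat_lia.
    by rewrite mul0r -{2}[d]mul1r -mulrDl kE p1E mul0r.
  by have := step true (2%:R * x) y (k - p)%N HW (stepT _); rewrite -subSn // leqW.
- rewrite /f prime_gt0 // ltnNge (_ : (p <= _)%N) /=; last by nat_lia.
  have kE : ((2 * p).-1 - p = p.-1)%N by nat_lia.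
  rewrite kE (_ : side p.-1 = false) /=; last by rewrite /side p1_even.
  rewrite /shift /row /= bicircE min0n (minn_idPr _); last by nat_lia.
  apply: (bicirc_subN HT') _ _; last by ring.
  by transitivity (d - (p.-1%:R + 1) * d); [ring | rewrite p1E mul0r subr0 opprK].
move=> s i; have [k kp kE] := Fp_multP p_pr i d0.
have [<-|sk] := eqVneq (side k) s.
  by exists k; [nat_lia | rewrite /f kp kE].
exists (p + k)%N; first by nat_lia.
rewrite /f ltnNge leq_addr /= addKn -kE; congr (_, _).
by case: (side k) sk => [] ; case: s.
Qed.

(* A Hamilton path of a 5-cycle with generator [c] ends at distance [c] from its
   start, in either direction, so a suitable choice of signs closes the walk. *)
Lemma ham_row_by_row (r : nat -> bool * 'F_p) (t : nat -> 'F_5) (c : bool -> 'F_5) :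
  (forall s, c s != 0) -> (forall s, C s s 0 (c s)) ->
  (forall j, (j.+1 < 2 * p)%N -> C (r j).1 (r j.+1).1 ((r j.+1).2 - (r j).2) (t j)) ->
  C (r (2 * p).-1).1 (r 0%N).1 ((r 0%N).2 - (r (2 * p).-1).2) (t (2 * p).-1) ->
  (forall s i, exists2 j, (j < 2 * p)%N & r j = (s, i)) ->
  hamiltonian E.
Proof.
move=> c0 Crow Cstep Cwrap rsurj.
have [||g [gE gsum]] := @signed_sum (2 * p) (fun l => c (r l).1) (\sum_(0 <= l < 2 * p) t l).
- by nat_lia.
- by move=> l; apply: c0.
have g0 j : g j != 0 by case: (gE j) => ->; rewrite ?oppr_eq0.
(* Four steps of [g j] amount to [- g j] in F_5, and [t j] leads to the next row; the signs were
   chosen so that these moves sum to zero. *)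
pose x j := \sum_(0 <= l < j) (t l - g l).
pose F j k := vtx (r j).1 (r j).2 (x j + k%:R * g j).
have xS j : x j.+1 = x j + (t j - g j) by rewrite /x big_nat_recr.
have x2p : x (2 * p)%N = x 0%N.
  by rewrite /x sumrB gsum subrr big_geq.
apply: (@ham_rows _ _ F (2 * p) 5) => //; first by nat_lia.
- by rewrite card_bivertex //; nat_lia.
- move=> j k _ _; rewrite /F bicircE subrr -natr1 (_ : _ - _ = g j); last by ring.
  by case: (gE j) => -> //; rewrite Csym oppr0 opprK.
- move=> j jp; rewrite /F bicircE; apply: bicirc_sub (Cstep j jp) _ _ => //=.
  by rewrite F5_mul4 xS; ring.
- rewrite /F bicircE; apply: bicirc_sub Cwrap _ _ => //=.
  have := xS (2 * p).-1; rewrite prednK ?x2p; last by nat_lia.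
  by move=> ->; rewrite F5_mul4; ring.
move=> [[s i] y]; have [j jp jE] := rsurj s i.
have [k k5 kE] := Fp_multP F5 (y - x j) (g0 j).
by exists j, k; split=> //; rewrite /F jE /= -kE /vtx addrCA subrr addr0.
Qed.

(** * Cycles built from the 5-cycles inside the S-orbits *)

Hypothesis Cirr : forall s, C s s 0 0 = false.

Lemma loop_neq0 s c : C s s 0 c -> c != 0.
Proof. by apply: contraTneq => ->; rewrite Cirr. Qed.

(** The S-orbits are visited along U in steps of [d], then along W backwards, which is why [y] and
    the closing [z] enter [t] negated. *)
Lemma ham_loops_cycle (d d' : 'F_p) (c c' x y z : 'F_5) : d != 0 ->
  C false false 0 c -> C true true 0 c' ->
  C false false d x -> C true true d y -> C false true d' z -> hamiltonian E.
Proof.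
move=> d0 Hc Hc' HU HW HT.
pose r j := if (j < p)%N then (false, j%:R * d) else (true, d' + (2 * p - j.+1)%:R * d).
pose t j := if (j.+1 < p)%N then x else if (j < p)%N then z else
  if (j.+1 < 2 * p)%N then - y else - z.
apply: (@ham_row_by_row r t (fun s => if s then c' else c)) => //.
- by case; apply: loop_neq0; eassumption.
- by case.
- move=> j jp; rewrite /r /t; case: (ltnP j.+1 p) => j1.
    by rewrite (ltn_trans _ j1) //=; apply: bicirc_sub HU _ _; rewrite -?natr1; ring.
  case: (ltnP j p) => j2 /=.
    have -> : (2 * p - j.+2 = j)%N by nat_lia.
    by apply: bicirc_sub HT _ _ => //; ring.
  rewrite jp; have -> : (2 * p - j.+1 = (2 * p - j.+2).+1)%N by nat_lia.
  by apply: (bicirc_subN HW) _ _ => //; rewrite -natr1; ring.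
- have [t1 t2 t3 t4] : [/\ ((2 * p).-1.+1 < p) = false, ((2 * p).-1 < p) = false,
    0 < p & (2 * p - (2 * p).-1.+1) = 0]%N by split; nat_lia.
  have t5 : ((2 * p).-1.+1 < 2 * p)%N = false by nat_lia.
  rewrite /r /t t1 t2 t3 t4 t5 /=; apply: (bicirc_subN HT) _ _ => //; ring.
case=> i.
  have [k kp kE] := Fp_multP p_pr (i - d') d0.
  exists (2 * p - k.+1)%N; first by nat_lia.
  have [t1 t2] : [/\ (2 * p - k.+1 < p)%N = false & (2 * p - (2 * p - k.+1).+1 = k)%N].
    by split; nat_lia.
  by rewrite /r t1 t2 -kE addrC subrK.
have [k kp kE] := Fp_multP p_pr i d0.
by exists k; [nat_lia | rewrite /r kp kE].
Qed.

(** The S-orbits are visited alternately on U and W; as [p] is odd, the parity of [j] and its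
    residue modulo [p] determine [j] modulo [2 * p]. *)
Lemma ham_loops_zigzag (d : 'F_p) (c c' z z' : 'F_5) : d != 0 ->
  C false false 0 c -> C true true 0 c' ->
  C false true d z -> C false true (- d) z' -> hamiltonian E.
Proof.
move=> d0 Hc Hc' HT HT'; have p0 := prime_gt0 p_pr.
pose r j := (odd j, j%:R * d).
pose t j := if odd j then - z' else z.
apply: (@ham_row_by_row r t (fun s => if s then c' else c)) => //.
- by case; apply: loop_neq0; eassumption.
- by case.
- move=> j _; rewrite /r /t /=; case: (odd j) => /=.
    by apply: (bicirc_subN HT') _ _ => //; rewrite -natr1; ring.
  by apply: bicirc_sub HT _ _ => //; rewrite -natr1; ring.
- have o1 : odd (2 * p).-1 by nat_lia.
  rewrite /r /t /= o1 mul0r; apply: (bicirc_subN HT') _ _ => //.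
  have : (2 * p).-1%:R + 1 = 0 :> 'F_p.
    by rewrite natr1 prednK ?muln_gt0 // natrM (Fp_charr p_pr) mulr0.
  by move/eqP; rewrite addr_eq0 => /eqP ->; ring.
move=> s i; have [k kp kE] := Fp_multP p_pr i d0.
have p_odd : odd p by case: (even_prime p_pr) => // p2; move: p7; rewrite p2.
exists (if odd k == s then k else k + p)%N; first by case: ifP => _; nat_lia.
rewrite /r; case: eqP => [->|/eqP sk]; first by rewrite kE.
rewrite oddD p_odd natrD (Fp_charr p_pr) addr0 kE; congr (_, _).
by case: (odd k) sk; case: (s).
Qed.

(** * Constraints from connectedness and from the automorphism [n] *)

Hypothesis con : connected_graph E.
Variable n : bivertex -> bivertex.
Hypotheses (n_inj : injective n) (nE : forall u w, E (n u) (n w) = E u w)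
  (n_idx : forall u, (n u).1.2 = u.1.2) (n0 : (n (vtx false 0 0)).1.1 = true).

Definition valency s t d := #|[pred x | C s t d x]|.

Lemma valencyE s t d : valency s t d = (\sum_(x : 'F_5) C s t d x)%N.
Proof.
rewrite /valency -sum1_card big_mkcond; apply: eq_bigr => x _.
by rewrite inE; case: (C _ _ _ _).
Qed.

Lemma valencyN s t d : valency s t (- d) = valency t s d.
Proof.
rewrite !valencyE (reindex_inj oppr_inj); apply: eq_bigr => x _.
by rewrite [in RHS]Csym.
Qed.

(** Counts neighbours on both sides together, because [n] preserves block indices but not
    necessarily sides. *)
Definition degree d (u : bivertex) :=
  (\sum_(w : bivertex) ((w.1.2 == (u.1.2 + d)%R) && E u w))%N.

Lemma degree_aut d u : degree d (n u) = degree d u.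
Proof.
rewrite /degree (reindex_inj n_inj); apply: eq_bigr => w _.
by rewrite !n_idx nE.
Qed.

Lemma degreeE d s i x : degree d (vtx s i x) = (valency s true d + valency s false d)%N.
Proof.
rewrite /degree -(pair_bigA _ (fun a y => ((a.2 == i + d) && E (vtx s i x) (a, y) : nat))) /=.
rewrite -(pair_bigA _ (fun t j => \sum_y ((j == (i + d)%R) && E (vtx s i x) (t, j, y) : nat)))%N /=.
have H t : (\sum_j \sum_y ((j == (i + d)%R) && E (vtx s i x) (t, j, y) : nat) = valency s t d)%N.
  rewrite (bigD1 (i + d)) //= [X in (_ + X)%N]big1 ?addn0; last first.
    by move=> j /negPf jd; rewrite big1 // => y _; rewrite jd.
  rewrite valencyE (reindex_inj (addrI x)) /=; apply: eq_bigr => y _.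
  by rewrite eqxx /bicirc /= !(addrC _ y) addrK (addrC i) addrK.
by rewrite big_bool /= !H.
Qed.

(** Comparing the degrees of a U-vertex and its image on W gives one equation for [d] and one for
    [- d]; their sum and difference are the two claims. *)
Lemma valency_eq d : valency false false d = valency true true d /\
  valency false true d = valency false true (- d).
Proof.
have H d' : (valency false true d' + valency false false d' =
    valency true true d' + valency true false d')%N.
  rewrite -(degreeE d' false 0 0) -degree_aut.
  by case: (n _) n0 => [[[] i] x] //= _; rewrite degreeE.
have := H d; have := H (- d); rewrite !valencyN; nat_lia.
Qed.

Lemma valency_gt0 s t d : (exists x, C s t d x) <-> (0 < valency s t d)%N.
Proof. by split=> [[x xP]|/card_gt0P[x xP]]; [apply/card_gt0P; exists x | exists x]. Qed.

Lemma loop_swap d : (exists x, C false false d x) <-> (exists x, C true true d x).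
Proof. by rewrite !valency_gt0; have [-> _] := valency_eq d. Qed.

Lemma spoke_opp d : (exists x, C false true d x) -> exists x, C false true (- d) x.
Proof. by rewrite !valency_gt0; have [_ ->] := valency_eq d. Qed.

Lemma loop_unique d : (forall x x', C false false d x -> C false false d x' -> x = x') ->
  forall x x', C true true d x -> C true true d x' -> x = x'.
Proof.
move=> H; have /card_le1_eqP H' : (valency true true d <= 1)%N.
  by have [<- _] := valency_eq d; apply/card_le1_eqP=> x x' xP x'P; apply: H.
by move=> x x' xP x'P; apply: H'.
Qed.

(* A coordinate [f], shifted on one side, would be constant on components. *)
Lemma not_separated (Z : zmodType) (f : 'F_p -> 'F_5 -> Z) (a : Z) i x :
  (forall i j x y, f (i - j) (x - y) = f i x - f j y) -> f i x != 0 ->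
  (forall s d y, C s s d y -> f d y = 0) ->
  (forall d y, C false true d y -> f d y = a) -> False.
Proof.
move=> fB fix0 Hs Ht.
pose phi (u : bivertex) := f u.1.2 u.2 - (if u.1.1 then a else 0).
have f00 : f 0 0 = 0 by rewrite -[0 in LHS](subrr 0) -[X in f _ X](subrr 0) fB subrr.
case/eqP: fix0; rewrite -f00.
have := @connected_const Z phi con _ (vtx false i x) (vtx false 0 0).
rewrite /phi /= !subr0; apply => u w.
case: u w => [[s j] y] [[t k] z]; rewrite /bicirc /=.
case: s t => [] [] H.
- by have := Hs _ _ _ H; rewrite fB => /eqP; rewrite subr_eq0 => /eqP->.
- by have := H; rewrite Csym !opprB => /Ht; rewrite fB subr0 => <-; rewrite subKr.
- by have := Ht _ _ H; rewrite fB subr0 => <-; rewrite subKr.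
- by have := Hs _ _ _ H; rewrite fB => /eqP; rewrite subr_eq0 => /eqP->.
Qed.

Lemma p_neq0_F5 : p%:R != 0 :> 'F_5.
Proof. by rewrite Fp_natr_eq0 // dvdn_prime2 //; nat_lia. Qed.

(* The differences [d] form a perfect matching of each block to a translate,
   and [n] commutes with it; so [n] multiplies by [y / x] from U to W and by
   [x / y] from W to U, and it must preserve the U-W edges. *)
Lemma matching_slopes (d : 'F_p) (x y x0 : 'F_5) : d != 0 ->
  C false false d x -> C true true d y ->
  (forall x', C false false d x' -> x' = x) -> (forall y', C true true d y' -> y' = y) ->
  (forall z, C false true d z = false) ->
  (exists d' z, C false true d' z) -> (forall d' z, C false true d' z -> z = x0) ->
  x * x = y * y.
Proof.
move=> d0 Cx Cy Ux Uy nT [d' [z' Tz]] UT.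
have nT' z : C true false d z = false.
  apply/negP => H; have [|w] := @spoke_opp (- d); last by rewrite opprK nT.
  by exists (- z); rewrite -Csym.
pose sl (s : bool) := if s then y else x.
pose ph u := shift d (sl u.1.1) u.
have Csl s : C s s d (sl s) by case: s.
have Usl s w : C s s d w -> w = sl s by case: s => [/Uy|/Ux].
have nph u : n (ph u) = ph (n u).
  have : E (n u) (n (ph u)).
    rewrite nE; case: u => [[s i] a]; rewrite /ph /shift bicircE /=.
    by apply: bicirc_sub (Csl s) _ _; ring.
  have := n_idx (ph u); rewrite /= -(n_idx u).
  case: (n u) (n (ph u)) => [[s i] a] [[t j] b] /= ->; rewrite /bicirc /=.
  rewrite addrAC subrr add0r; case: s t => [] [] //; rewrite ?nT ?nT' //.
    by move/(Usl true); rewrite /ph /shift /vtx /sl /= => <-; rewrite [a + _]addrC subrK.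
  by move/(Usl false); rewrite /ph /shift /vtx /sl /= => <-; rewrite [a + _]addrC subrK.
have nphk k s i a : n (vtx s (i + k%:R * d) (a + k%:R * sl s)) =
    (let u := n (vtx s i a) in vtx u.1.1 (u.1.2 + k%:R * d) (u.2 + k%:R * sl u.1.1)).
  elim: k => [|k IH]; first by rewrite /= !mul0r !addr0; case: (n _) => [[]].
  have -> : vtx s (i + k.+1%:R * d) (a + k.+1%:R * sl s) =
      ph (vtx s (i + k%:R * d) (a + k%:R * sl s)).
    by rewrite /ph /shift /vtx /= -!natr1; congr (_, _, _); ring.
  by rewrite nph IH /ph /shift /vtx /= -!natr1; congr (_, _, _); ring.
have [w0 n00] : exists w0, n (vtx false 0 0) = vtx true 0 w0.
  have := n_idx (vtx false 0 0).
  by case: (n _) n0 => [[s i] a] /= -> ->; exists a.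
have nU k : n (vtx false (k%:R * d) (k%:R * x)) = vtx true (k%:R * d) (w0 + k%:R * y).
  by have := nphk k false 0 0; rewrite n00 /= !add0r.
(* After [p] steps of [ph] the F_p coordinate returns, so [n] carries the translation by [p * x] on
   U to that by [p * y] on W. *)
have xy0 : (x == 0) = (y == 0).
  have := nU p; rewrite (Fp_charr p_pr) !mul0r => np; apply/eqP/eqP => H.
    move: np; rewrite H mulr0 n00 => /(congr1 snd)/eqP /=.
    by rewrite -subr_eq0 opprD addNKr oppr_eq0 mulf_eq0 (negPf p_neq0_F5) => /eqP.
  move: np; rewrite H mulr0 addr0 -n00 => /n_inj/(congr1 snd)/eqP /=.
  by rewrite mulf_eq0 (negPf p_neq0_F5) => /eqP.
have [/eqP x_0|x_neq0] := boolP (x == 0).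
  by move: xy0; rewrite x_0 eqxx => /esym/eqP ->.
have y_neq0 : y != 0 by rewrite -xy0.
have p5 : p != 5 by nat_lia.
have nUE i a : n (vtx false i a) = vtx true i (w0 + a / x * y).
  have [k [_ -> ->]] := Fp_chinese p_pr F5 i a p5 d0 x_neq0.
  by rewrite nU mulfK.
(* The image of U under [n] already fills W, so by injectivity W is sent to U. *)
have [z1 nW0] : exists z1, n (vtx true 0 0) = vtx false 0 z1.
  have := n_idx (vtx true 0 0).
  case nW: (n _) => [[[] i] z] /= i0; last by exists z; rewrite i0.
  suff : n (vtx false 0 ((z - w0) / y * x)) = n (vtx true 0 0) by move/n_inj.
  by rewrite nUE nW i0 mulfK // divfK // addrC subrK.
have nWE i a : n (vtx true i a) = vtx false i (z1 + a / y * x).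
  have [k [_ -> ->]] := Fp_chinese p_pr F5 i a p5 d0 y_neq0.
  by have := nphk k true 0 0; rewrite nW0 /= !add0r mulfK.
have H a : w0 + a / x * y - (z1 + (a + z') / y * x) = x0.
  have : E (n (vtx false 0 a)) (n (vtx true d' (a + z'))).
    by rewrite nE bicircE subr0 addrC addKr.
  by rewrite nUE nWE bicircE Csym => /UT; rewrite opprB.
have H0 := H 0; have := H (x * y); rewrite -H0.
rewrite !mul0r addr0 add0r mulrDl mulrDl (mulrAC x) divff // mul1r mulfK //.
by move/eqP; rewrite -subr_eq0 => /eqP e; apply/eqP; rewrite eq_sym -subr_eq0 -e; apply/eqP; ring.
Qed.

Theorem bicirc_hamiltonian : hamiltonian E.
Proof.
have [//|nH] := hamiltonianP E.
have loops := loop_swap.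
have opp := spoke_opp.
have line d d' z z' : C false true d z -> C false true d' z' -> d = d' \/ z = z'.
  have [->|dd] := eqVneq d d'; first by left.
  have [->|zz] := eqVneq z z'; first by right.
  by move=> H H'; case: nH; apply: ham_haar dd zz H H'.
have sep1 a : (forall s d y, C s s d y -> d = 0) ->
    (forall d y, C false true d y -> d = a) -> False.
  by apply: (@not_separated 'F_p (fun d _ => d) a 1 0) => //; rewrite oner_neq0.
have sep2 a : (forall s d y, C s s d y -> y = 0) ->
    (forall d y, C false true d y -> y = a) -> False.
  by apply: (@not_separated 'F_5 (fun _ x => x) a 0 1).
have [d0 [z0 T0]] : exists d z, C false true d z.
  have [/existsP[d /existsP[z H]]|] := boolP [exists d, exists z, C false true d z].
    by exists d, z.
  rewrite negb_exists => /forallP nT.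
  suff : false = true by [].
  apply: (connected_const (phi := fun u : bivertex => u.1.1) con _ (vtx false 0 0) (vtx true 0 0)).
  case=> [[s i] x] [[t j] y]; rewrite /bicirc /=.
  case: s t => [] [] //= H; exfalso.
    move: (nT (- (j - i))); rewrite negb_exists => /forallP/(_ (- (y - x))).
    by rewrite -Csym H.
  by move: (nT (j - i)); rewrite negb_exists => /forallP/(_ (y - x)); rewrite H.
have [/existsP[d /andP[d_neq0 /existsP[x Hx]]]|noloop] :=
  boolP [exists d, (d != 0) && [exists x, C false false d x]].
  (* Two choices for one step would give two displacements in [ham_double_path]; without a Hamilton
     cycle both vanish, so the choices agree. *)
  have uniqU d1 x1 x2 : d1 != 0 -> C false false d1 x1 -> C false false d1 x2 -> x1 = x2.
    move=> d10 H1 H2; have [y Hy] : exists y, C true true d1 y by apply/loops; exists x1.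
    have := contra_not_eq (fun v0 => ham_double_path d10 H1 H1 Hy T0 T0 v0) nH.
    have := contra_not_eq (fun v0 => ham_double_path d10 H1 H2 Hy T0 T0 v0) nH.
    move=> <- /eqP; rewrite -subr_eq0 => /eqP e.
    by apply/eqP; rewrite -subr_eq0 -e; apply/eqP; ring.
  have uniqW d1 : d1 != 0 -> forall x1 x2, C true true d1 x1 -> C true true d1 x2 -> x1 = x2.
    move=> d10; apply: (loop_unique) => x1 x2.
    exact: uniqU.
  have [y Hy] : exists y, C true true d y by apply/loops; exists x.
  have uniqT d1 z1 z2 : C false true d1 z1 -> C false true d1 z2 -> z1 = z2.
    move=> H1 H2.
    have := contra_not_eq (fun v0 => ham_double_path d_neq0 Hx Hx Hy H1 H1 v0) nH.
    have := contra_not_eq (fun v0 => ham_double_path d_neq0 Hx Hx Hy H1 H2 v0) nH.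
    move=> <- /eqP; rewrite -subr_eq0 => /eqP e.
    by apply/eqP; rewrite -subr_eq0 -e; apply/eqP; ring.
  have constT d1 z1 : C false true d1 z1 -> z1 = z0.
    by move=> H1; case: (line _ _ _ _ H1 T0) => // e; move: H1; rewrite e => /uniqT/(_ T0).
  have noc c : C false false 0 c = false.
    apply/negP => Hc; have [c' Hc'] : exists c', C true true 0 c' by apply/loops; exists c.
    by apply: nH; apply: ham_loops_cycle d_neq0 Hc Hc' Hx Hy T0.
  have noc' c : C true true 0 c = false.
    by apply/negP => Hc; have [|c' ] := (loops 0).2; [exists c | rewrite noc].
  (* This makes the F_5 coordinate constant along U-U and W-W edges, contradicting [sep2]. When
     [x1 + y1] is nonzero, either [d1] carries a U-W edge and [ham_wreath] applies, or
     [matching_slopes] forces [x1 = y1] and [ham_prism] applies. *)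
  have zero d1 x1 y1 : C false false d1 x1 -> C true true d1 y1 -> x1 = 0 /\ y1 = 0.
    have [->|d10] := eqVneq d1 0; first by rewrite noc.
    move=> H1 H2; have [s0|s_neq0] := eqVneq (x1 + y1) 0.
      have yE : y1 = - x1 by apply/eqP; rewrite -addr_eq0 addrC s0.
      have [x10|x1_neq0] := eqVneq x1 0; first by rewrite yE x10 oppr0.
      by rewrite yE in H2; case: nH; apply: ham_twisted_prism d10 x1_neq0 H1 H2 T0.
    case: (boolP [exists z, C false true d1 z]) => [/existsP[z Hz]|].
      have [z' Hz'] : exists z', C false true (- d1) z' by apply: opp; exists z.
      have zz : z' = z by rewrite (constT _ _ Hz) (constT _ _ Hz').
      by rewrite zz in Hz'; case: nH; apply: ham_wreath d10 H1 H2 Hz Hz' s_neq0.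
    rewrite negb_exists => /forallP nT.
    have /eqP : x1 * x1 = y1 * y1.
      apply: (matching_slopes d10 H1 H2) (constT).
      - by move=> x' Hx'; apply: uniqU Hx' H1.
      - by move=> y' Hy'; apply: uniqW Hy' H2.
      - by move=> z; apply/negbTE.
      - by exists d0, z0.
    rewrite -subr_eq0 (_ : _ - _ = (x1 - y1) * (x1 + y1)); last by ring.
    rewrite mulf_eq0 (negPf s_neq0) orbF subr_eq0 => /eqP e.
    move: s_neq0 H2; rewrite -e => s_neq0 H2.
    have x1_neq0 : x1 != 0 by apply: contraNneq s_neq0 => ->; rewrite addr0.
    by case: nH; apply: ham_prism d10 x1_neq0 H1 H2 T0.
  case: (sep2 z0) => // -[] d1 y1 H1.
    have [x1 H2] : exists x1, C false false d1 x1 by apply/loops; exists y1.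
    by have [] := zero _ _ _ H2 H1.
  have [x1 H2] : exists x1, C true true d1 x1 by apply/loops; exists y1.
  by have [] := zero _ _ _ H1 H2.
(* From here on, U-U and W-W edges stay inside a single S-orbit. *)
have loop0 s d y : C s s d y -> d = 0.
  move=> H; apply/eqP; apply: contraNT noloop => d_neq0; apply/existsP; exists d.
  have [x Hx] : exists x, C false false d x.
    by case: s H => H; [apply/loops; exists y | exists y].
  by rewrite d_neq0; apply/existsP; exists x.
have [/existsP[c Hc]|noc] := boolP [exists c, C false false 0 c].
  have [c' Hc'] : exists c', C true true 0 c' by apply/loops; exists c.
  case: (sep1 0) => // d z Hz; apply/eqP; apply: contra_notT nH => d_neq0.
  have [z' Hz'] : exists z', C false true (- d) z' by apply: opp; exists z.
  exact: ham_loops_zigzag d_neq0 Hc Hc' Hz Hz'.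
have nol s d y : C s s d y = false.
  apply/negP => H; case/negP: noc; apply/existsP; rewrite -(loop0 _ _ _ H).
  by case: s H => H; [apply/loops; exists y | exists y].
exfalso.
(* Only U-W edges remain and their differences lie on a line, so one coordinate is constant on them,
   contrary to connectedness. *)
case: (boolP [exists d, exists z, (z != z0) && C false true d z]).
  case/existsP=> d1 /existsP[z1 /andP[z10 T1]].
  have dE : d1 = d0 by case: (line _ _ _ _ T1 T0) => // /eqP; rewrite (negPf z10).
  apply: (sep1 d0) => [s d y|d z Hz]; first by rewrite nol.
  case: (line _ _ _ _ Hz T0) => // zE; case: (line _ _ _ _ Hz T1) => [->//|] zE'.
  by move: z10; rewrite -zE' zE eqxx.
rewrite negb_exists => /forallP H; apply: (sep2 z0) => [s d y|d z Hz]; first by rewrite nol.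
move: (H d); rewrite negb_exists => /forallP/(_ z); rewrite Hz andbT negbK.
exact: eqP.
Qed.

End Bicirculant.

(** * Groups all of whose orbits have size five *)

Import GroupScope.

Lemma expg_indexg_mem (gT : finGroupType) (H K : {group gT}) (t : gT) :
  K <| H -> t \in H -> t ^+ #|H : K| \in K.
Proof.
move=> /[dup] nKH /andP[_ nK] tH; have tN := subsetP nK _ tH.
apply: coset_idr; first exact: groupX.
rewrite morphX //; apply/eqP; rewrite -order_dvdn -card_quotient //.
by rewrite order_dvdG // mem_quotient.
Qed.

Lemma expg_coprime_mem (gT : finGroupType) (K : {group gT}) (t : gT) (k m : nat) :
  t ^+ k \in K -> t ^+ m \in K -> coprime k m -> t \in K.
Proof.
case: k => [_ tm|k tk tm co].
  by rewrite /coprime gcd0n => /eqP m1; rewrite -[t]expg1 -m1.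
have [a b eab _] := egcdnP m (isT : 0 < k.+1).
rewrite (eqP co) in eab; have : t ^+ (a * k.+1) \in K by rewrite mulnC expgM groupX.
by rewrite eab expgD expg1 mulnC expgM groupMl // groupX.
Qed.

(** The units modulo 5 form a group of order 4, on which an odd power map is injective. *)
Lemma expn_mod5 (c p : nat) : odd p -> c ^ p = 1 %[mod 5] -> c = 1 %[mod 5].
Proof.
move=> p_odd; have [q pE] : exists q, p = q.*2.+1.
  by exists p./2; rewrite -[LHS]odd_double_half p_odd.
rewrite -modnXm pE -[q]odd_double_half !doubleD.
have -> : ((odd q).*2 + q./2.*2.*2).+1 = 4 * q./2 + (odd q).*2.+1 by lia.
rewrite expnD expnM -modnMml -modnXm.
have : c %% 5 < 5 by rewrite ltn_mod.
case: (c %% 5) => [|[|[|[|[|//]]]]] _; case: (odd q).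
all: rewrite ?[_ %% 5 in _ ^ q./2]/= ?exp1n ?muln0 //.
Qed.

Lemma p_elt_orbit1 (gT : finGroupType) (rT : finType) (to : {action gT &-> rT})
    (p : nat) (z : gT) (y : rT) :
  p.-elt z -> #|orbit to <[z]> y| < p -> to y z = y.
Proof.
move=> pz lt_p; suff /orbit1P/afixP/(_ z (cycle_id z)) : orbit to <[z]> y = [set y] by [].
have /p_natP[e oE] : p.-nat #|orbit to <[z]> y|.
  by rewrite card_orbit; apply: pnat_dvd (dvdn_indexg _ _) pz.
apply/eqP; rewrite eq_sym eqEcard sub1set orbit_refl cards1 oE.
case: e oE lt_p => // e ->; rewrite expnS; case: p {pz} => // p.
by rewrite ltnNge leq_pmulr // expn_gt0.
Qed.

Lemma Aut_graphP (V : finType) (e : rel V) (h : {perm V}) :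
  reflect (forall x y, e (h x) (h y) = e x y) (h \in Aut_graph e).
Proof.
rewrite inE; apply: (iffP forallP) => [H x y|H x]; last by apply/forallP=> y; rewrite H.
exact: eqP (forallP (H x) y).
Qed.

Section FiveGroup.
Variables (V : finType) (S : {group {perm V}}).
Hypotheses (S5 : 5.-group S) (orbS : forall y, #|orbit 'P S y| = 5).

(** A subgroup of index 5 in a 5-group is maximal, hence normal. *)
Let stab y : 'C_S[y | 'P] <| S.
Proof.
apply: (p_maximal_normal S5); apply: p_index_maximal; first exact: subsetIl.
by rewrite -card_orbit orbS.
Qed.

Let mem_stab y s : s \in 'C_S[y | 'P] -> s y = y.
Proof. by case/setIP=> _ /astab1P. Qed.

(** Each point stabiliser has a quotient of order 5, so the derived subgroup fixes every point. *)
Lemma orbits5_abelian : abelian S.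
Proof.
suff : S^`(1) \subset [1] by rewrite derg1 => /trivgP/commG1P.
apply/subsetP=> s sS'; rewrite inE; apply/eqP/permP=> y.
rewrite perm1; apply: mem_stab; apply: subsetP sS'.
have /andP[_ nS] := stab y.
apply: der1_min => //; apply: cyclic_abelian; apply: prime_cyclic.
by rewrite card_quotient // -card_orbit orbS.
Qed.

Lemma orbits5_exponent s : s \in S -> s ^+ 5 = 1.
Proof.
move=> sS; apply/permP=> y; rewrite perm1; apply: mem_stab.
by rewrite -(orbS y) card_orbit; apply: expg_indexg_mem (stab y) sS.
Qed.

Lemma orbits5C s t : s \in S -> t \in S -> s * t = t * s.
Proof. by move=> sS tS; apply: (centsP orbits5_abelian). Qed.

(** The orbit of [y] under [k] has 5-power length greater than 1, so it is the whole S-orbit. *)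
Lemma orbits5_cycle k y s : k \in S -> k y != y -> s \in S ->
  exists m, s y = (k ^+ m) y.
Proof.
move=> kS ky sS.
have sub : orbit 'P <[k]> y \subset orbit 'P S y by apply: imsetS; rewrite cycle_subG.
have : s y \in orbit 'P S y by apply: mem_orbit.
suff <- : orbit 'P <[k]> y = orbit 'P S y.
  by case/orbitP=> _ /cycleP[m ->] <-; exists m.
apply/eqP; rewrite eqEcard sub orbS leqNgt; apply/negP=> lt5.
by case/eqP: ky; apply: (p_elt_orbit1 (to := 'P) _ lt5); apply: mem_p_elt S5 kS.
Qed.

Lemma orbits5_expg k y m m' : k \in S -> k y != y -> (k ^+ m) y = (k ^+ m') y ->
  m = m' %[mod 5].
Proof.
wlog le_mm : m m' / m <= m'.
  by move=> H kS ky e; case/orP: (leq_total m m') => /H; [|move=> H'; symmetry]; auto.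
move=> kS ky e; apply/eqP; rewrite eq_sym eqn_mod_dvd //; apply/idPn => n5.
have fixy : (k ^+ (m' - m)) y = y.
  apply: (@perm_inj _ (k ^+ m)); rewrite -permM -expgD subnK //.
case/eqP: ky; apply: mem_stab; apply: (@expg_coprime_mem _ _ _ (m' - m) 5).
- by rewrite inE groupX //; apply/astab1P.
- by rewrite orbits5_exponent.
- by rewrite coprime_sym prime_coprime.
Qed.

Lemma expg_agree s s' y m : s \in S -> s' \in S -> s y = s' y -> (s ^+ m) y = (s' ^+ m) y.
Proof.
move=> sS s'S e; elim: m => // m IH; rewrite expgSr permM IH expgS permM -e.
by rewrite -!permM orbits5C ?groupX.
Qed.

(** Point stabilisers being normal in [S], this compares the kernels of [S] on the two orbits;
    [fix_le_sym] turns containment into equality. *)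
Definition fix_le y y' := [forall k in S, (k y == y) ==> (k y' == y')].

Lemma fix_leP y y' : reflect (forall k, k \in S -> k y = y -> k y' = y') (fix_le y y').
Proof.
apply: (iffP forall_inP) => H k kS; last by apply/implyP => /eqP/H ->.
by move/eqP => e; apply/eqP; apply: (implyP (H k kS)).
Qed.

Lemma fix_le_sym y y' : fix_le y y' -> fix_le y' y.
Proof.
move/fix_leP => H; apply/fix_leP => k kS ky'; apply/eqP/idPn => ky.
have : #|orbit 'P S y'| <= 1.
  rewrite -(cards1 y') subset_leq_card //; apply/subsetP => _ /orbitP[s sS <-].
  have [m e] := orbits5_cycle kS ky sS; have /(groupX m) kmS := kS.
  have : (s * (k ^+ m)^-1) y' = y'.
    by apply: H; rewrite ?groupM ?groupV // permM e permK.
  rewrite inE permM /= apermE => /(canRL (permKV _)) ->.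
  by apply/eqP; elim: (m) => [|j IH]; rewrite ?perm1 // expgS permM ky'.
by rewrite orbS.
Qed.

Lemma fix_le_trans y1 y2 y3 : fix_le y1 y2 -> fix_le y2 y3 -> fix_le y1 y3.
Proof. by move=> /fix_leP H /fix_leP H'; apply/fix_leP => k kS /H/H'; apply. Qed.

Lemma fix_le_norm g y y' : g \in 'N(S) -> fix_le y y' -> fix_le (g y) (g y').
Proof.
move=> gN /fix_leP H; apply/fix_leP => k kS e.
have kS' : g * k * g^-1 \in S by rewrite -mulgA -{1}[g]invgK memJ_norm ?groupV.
have := H _ kS'; rewrite !permM e permK => /(_ erefl)/(canRL (permKV _)) ->.
by [].
Qed.

(* A [p]-element acts trivially on the quotient of order 5 of [S] by a point stabiliser. *)
Lemma p_elt_commutes p g b t : odd p -> g \in 'N(S) -> g ^+ p = 1 ->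
  t \in S -> t b != b -> fix_le b (g b) -> (g * t) b = (t * g) b.
Proof.
move=> p_odd gN gp tS tb /fix_leP fixg.
pose h := g^-1; have hN : h \in 'N(S) by rewrite groupV.
have jS j s : s \in S -> s ^ (h ^+ j) \in S by move=> sS; rewrite memJ_norm // groupX.
have j1S s : s \in S -> s ^ h \in S by move=> sS; rewrite memJ_norm.
have conjhE s : s ^ h = g * s * g^-1 by rewrite conjgE /h invgK mulgA.
have fixh k : k \in S -> k b = b -> (k ^ h) b = b.
  by move=> kS kb; rewrite conjhE !permM fixg // permK.
have agree s s' : s \in S -> s' \in S -> s b = s' b -> (s ^ h) b = (s' ^ h) b.
  move=> sS s'S e; have := fixh (s * s'^-1).
  rewrite groupM ?groupV // permM e permK => /(_ isT erefl).
  by rewrite conjMg conjVg permM => /(canRL (permKV _)).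
(* Conjugation by [h] acts on the orbit of [b] as a multiplier [c]; then [c ^ p] is 1 modulo 5, and
   [p] being odd, so is [c]. *)
have [c cE] := orbits5_cycle tS tb (j1S t tS).
have iter j : (t ^ (h ^+ j)) b = (t ^+ (c ^ j)%N) b.
  elim: j => [|j IH]; first by rewrite conjg1.
  rewrite expgSr conjgM (agree _ (t ^+ (c ^ j)%N)) ?groupX ?jS // conjXg.
  have e := expg_agree (c ^ j)%N (j1S t tS) (groupX c tS) cE.
  by rewrite e -expgM expnS.
have := iter p; rewrite expgVn gp invg1 conjg1 -{1}[t]expg1.
move/(orbits5_expg tS tb)/esym/(expn_mod5 p_odd) => c1.
apply: (@perm_inj _ g^-1); rewrite -!permM -conjhE cE mulgK.
by rewrite -(expg_mod _ (orbits5_exponent tS)) c1 expg1.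
Qed.

Lemma exists_moving y : exists2 s, s \in S & s y != y.
Proof.
have /subsetPn[_ /orbitP[s sS <-]] : ~~ (orbit 'P S y \subset [set y]).
  by apply/negP => /subset_leq_card; rewrite orbS cards1.
by rewrite inE; exists s.
Qed.

(** Some [k] fixes [y] and moves [y'], so its powers carry [y'] through its whole S-orbit: the two
    orbits are joined completely or not at all. *)
Lemma edge_const (e : rel V) y y' s s' : S \subset Aut_graph e ->
  ~~ fix_le y y' -> s \in S -> s' \in S -> e (s y) (s' y') = e y y'.
Proof.
move=> SA /forallPn[k]; rewrite !negb_imply => /and3P[kS /eqP ky ky'] sS s'S.
have aut h (hS : h \in S) := Aut_graphP _ _ (subsetP SA h hS).
have s's : s' * s^-1 \in S by rewrite groupM ?groupV.
rewrite -(aut s^-1 (groupVr sS)) permK -permM.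
have [m ->] := orbits5_cycle kS ky' s's.
have kmy : (k ^+ m) y = y by elim: (m) => [|j IH]; rewrite ?perm1 // expgS permM ky.
by rewrite -{1}kmy (aut _ (groupX m kS)).
Qed.

(** If some translate of the orbit of [w] has the same kernel as that of [u], [r] is [t] transported
    back from it; otherwise any [r] moving [w] will do. *)
Lemma exists_aligned p g u w t : odd p -> g \in 'N(S) -> g ^+ p = 1 ->
  t \in S -> t u != u -> exists r, [/\ r \in S, r w != w &
    forall d, fix_le u ((g ^+ d) w) -> (g ^+ d * t) w = (r * g ^+ d) w].
Proof.
move=> p_odd gN gp tS tu.
have [/existsP[[d0 d0p] /= fix0]|] := boolP [exists d : 'I_p, fix_le u ((g ^+ d) w)]; last first.
  rewrite negb_exists => /forallP nfix; have [r rS rw] := exists_moving w.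
  exists r; split=> // d; rewrite -(expg_mod _ gp).
  have p0 : 0 < p by case: p p_odd {gp nfix}.
  by rewrite (negPf (nfix (Ordinal (ltn_pmod d p0)))).
have gXN d : g ^+ d \in 'N(S) by rewrite groupX.
have gV : g ^+ (p - d0) = (g ^+ d0)^-1.
  by apply: (mulgI (g ^+ d0)); rewrite mulgV -expgD subnKC // ltnW.
have fix0' := fix_le_sym fix0.
pose r := g ^+ d0 * t * (g ^+ d0)^-1.
have rS : r \in S by rewrite /r -mulgA -{1}[g ^+ d0]invgK memJ_norm // groupV.
have rw : r w != w.
  apply: contra tu => /eqP; rewrite !permM => /(canRL (permKV _)) e.
  by apply/eqP; move/fix_leP: fix0'; apply.
exists r; split=> // d fixd; apply: (@perm_inj _ (g ^+ d0)^-1); rewrite -!permM.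
(* Transported back by [g ^+ d0], the orbits at [d0] and [d] show that [w] and its image under
   [g ^+ (d + (p - d0))] have the same kernel. *)
have := fix_le_norm (gXN (p - d0)) (fix_le_trans fix0' fixd).
rewrite -!permM -!expgD subnKC ?gp ?perm1; last exact: ltnW.
move=> fixw; have gdp : (g ^+ (d + (p - d0))) ^+ p = 1 by rewrite -expgM mulnC expgM gp expg1n.
have := p_elt_commutes p_odd (gXN _) gdp rS rw fixw.
by rewrite expgD gV /r !mulgA mulgKV.
Qed.

End FiveGroup.

(** * Block systems with blocks of size ten *)

Section Blocks.
Variables (V : finType) (p : nat) (G N : {group {perm V}}).
Hypotheses (p_pr : prime p) (p7 : 7 <= p) (cardV : #|V| = (10 * p)%N)
  (transG : [transitive G, on [set: V] | 'P]) (nNG : N <| G)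
  (orbN : forall x : V, #|orbit 'P N x| = 10).

(** The orbit length is a power of 5 at most 10. Length 1 would put [S] in a point stabiliser of
    [N], whose 5-part is five times smaller. *)
Lemma sylow5_orbit (S : {group {perm V}}) y : 5.-Sylow(N) S -> #|orbit 'P S y| = 5.
Proof.
move=> /[dup] sylS /and3P[sSN pS _].
have le10 : #|orbit 'P S y| <= 10 by rewrite -(orbN y) subset_leq_card // imsetS.
have /p_natP[e oE] : 5.-nat #|orbit 'P S y|.
  by rewrite card_orbit; apply: pnat_dvd (dvdn_indexg _ _) pS.
have cN : #|N| = (10 * #|'C_N[y | 'P]|)%N by rewrite -(orbN y) card_orbit mulnC Lagrange ?subsetIl.
have cS : #|S| = (5 ^ e * #|'C_S[y | 'P]|)%N by rewrite -oE card_orbit mulnC Lagrange ?subsetIl.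
have dvd : #|'C_S[y | 'P]| %| #|'C_N[y | 'P]|`_5.
  rewrite -(part_pnat_id (pgroupS (subsetIl S _) pS)); apply: partn_dvd => //.
  by rewrite cardSg // setSI.
have := card_Hall sylS; rewrite cN partnM // cS (_ : 10`_5 = 5)%N; last by rewrite p_part.
move=> e5; rewrite oE in le10 *; case: e e5 le10 {oE cS} => [|[|e]] //.
  rewrite mul1n => e5 _; move: (dvdn_leq (part_gt0 _ _) dvd).
  by rewrite e5 leqNgt ltn_Pmull ?part_gt0.
by move=> _; rewrite !expnS; have := expn_gt0 5 e; lia.
Qed.

(** The setwise stabiliser in [G] of the block of [x], of index [p]. *)
Let L x := 'C_G[x | 'P] <*> N.

Let LE x : L x = 'C_G[x | 'P] * N.
Proof. by rewrite /L norm_joinEl // (subset_trans (subsetIl _ _)) // normal_norm. Qed.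

Let LG x : L x \subset G.
Proof. by rewrite join_subG subsetIl normal_sub. Qed.

Let memL x h : h \in G -> (h \in L x) = (h x \in orbit 'P N x).
Proof.
move=> hG; rewrite LE; apply/mulsgP/orbitP.
  case=> c n /setIP[_ /astab1P]; rewrite /= apermE => cx nN ->.
  by exists n => //; rewrite /= apermE permM cx.
case=> n nN; rewrite /= !apermE => e; exists (h * n^-1) n; rewrite ?mulgKV //.
have nG := subsetP (normal_sub nNG) _ nN; rewrite inE groupM ?groupV //.
by apply/astab1P; rewrite /= apermE permM -e permK.
Qed.

Let cardG x : #|G| = (p * #|L x|)%N.
Proof.
have cG : #|G| = (10 * p * #|'C_G[x | 'P]|)%N.
  by rewrite -cardV -cardsT -(atransP transG x (in_setT x)) card_orbit mulnC Lagrange ?subsetIl.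
have cN : #|N| = (10 * #|'C_N[x | 'P]|)%N.
  by rewrite -(orbN x) card_orbit mulnC Lagrange ?subsetIl.
have := mul_cardG 'C_G[x | 'P]%G N; rewrite -LE.
have -> : 'C_G[x | 'P] :&: N = 'C_N[x | 'P].
  by rewrite setIAC (setIidPr (normal_sub nNG)).
rewrite cG cN => e; have C0 := cardG_gt0 'C_N[x | 'P]%G.
by apply/eqP; rewrite -(eqn_pmul2r C0) -!mulnA -e; apply/eqP; ring.
Qed.

Lemma orbit_im x y h : h \in G -> y \in orbit 'P N x -> h y \in orbit 'P N (h x).
Proof.
move=> hG /orbitP[n nN <-]; apply/orbitP; exists (n ^ h).
  by rewrite memJ_norm // (subsetP (normal_norm nNG)).
by rewrite /= !apermE -!permM [n * h]conjgC.
Qed.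

Lemma exists_block_rotation : exists S : {group {perm V}}, exists2 g : {perm V},
  [/\ S \subset N, 5.-group S, g \in G & g \in 'N(S)] &
  [/\ forall y, #|orbit 'P S y| = 5, g ^+ p = 1 &
    exists x, forall k, (g ^+ k) x \in orbit 'P N x -> p %| k].
Proof.
have [S sylS] := Sylow_exists 5 N; have [sSN S5 _] := and3P sylS.
have orbS y := sylow5_orbit y sylS.
have frat := Frattini_arg nNG sylS.
have /card_gt0P[x0 _] : 0 < #|V| by rewrite cardV muln_gt0 (prime_gt0 p_pr).
have [P sylP] := Sylow_exists p 'N_G(S).
have [sPM pP _] := and3P sylP.
(* As [N_G(S)] and [L x0] multiply to [G], their intersection has index [p] in [N_G(S)], so it
   contains no Sylow p-subgroup of it. *)
have /subsetPn[g gP gL] : ~~ (P \subset L x0).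
  apply/negP => sPL.
  have := mul_cardG 'N_G(S)%G (L x0)%G.
  have -> : 'N_G(S) * L x0 = G.
    have nN : 'N_G(S) \subset 'N(N) by rewrite (subset_trans (subsetIl _ _)) ?normal_norm.
    have frat' : 'N_G(S) * N = G by rewrite normC.
    apply/eqP; rewrite eqEsubset mul_subG ?subsetIl ?LG //=.
    by apply: (@subset_trans _ _ ('N_G(S) * N)); [rewrite frat' | rewrite mulgS // joing_subr].
  rewrite (cardG x0) -mulnA [(_ * #|_ :&: _|)%N]mulnC mulnA => /eqP.
  rewrite eqn_pmul2r ?cardG_gt0 // => /eqP cM.
  have := card_Hall sylP; rewrite cM partnM ?cardG_gt0 ?(prime_gt0 p_pr) //.
  rewrite part_pnat_id ?pnat_id // => cP.
  have : #|P| %| #|'N_G(S) :&: L x0|`_p.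
    rewrite -(part_pnat_id pP); apply: partn_dvd; rewrite ?cardG_gt0 //.
    by apply: cardSg; rewrite subsetI sPM.
  move/(dvdn_leq (part_gt0 _ _)); rewrite cP leqNgt ltn_Pmull ?part_gt0 //.
  exact: prime_gt1.
have /setIP[gG gN] := subsetP sPM _ gP.
have pg : p.-elt g := mem_p_elt pP gP.
have sgG : <[g]> \subset G by rewrite cycle_subG.
(* The index is a power of [p], at most [p] because [L x0] has index [p], and not 1 because [g] lies
   outside. *)
have idx : #|<[g]> : <[g]> :&: L x0| = p.
  have /p_natP[e eE] : p.-nat #|<[g]> : <[g]> :&: L x0|.
    by apply: pnat_dvd (dvdn_indexg _ _) pg.
  have le_p : #|<[g]> : <[g]> :&: L x0| <= p.
    have := mul_cardG <[g]>%G (L x0)%G; rewrite -(Lagrange (subsetIl <[g]> (L x0))).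
    rewrite -mulnA mulnC => /eqP.
    rewrite eqn_pmul2r ?cardG_gt0 // => /eqP => e1.
    rewrite -(leq_pmul2r (cardG_gt0 (L x0)%G)) -cardG e1.
    by rewrite subset_leq_card // mul_subG ?LG.
  rewrite eE in le_p *; case: e eE le_p => [|[|e]] // eE.
    move/eqP: eE; rewrite indexg_eq1 subsetI subxx cycle_subG /=.
    by rewrite (negPf gL).
  rewrite !expnS leqNgt ltn_Pmulr ?(prime_gt0 p_pr) //.
  by rewrite (leq_trans (prime_gt1 p_pr)) // leq_pmulr // expn_gt0 prime_gt0.
have zL : g ^+ p \in L x0.
  have : g ^+ #|<[g]> : <[g]> :&: L x0| \in <[g]> :&: L x0.
    apply: (@expg_indexg_mem _ _ (<[g]> :&: L x0)%G); rewrite ?cycle_id //.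
    by rewrite -sub_abelian_normal ?cycle_abelian ?subsetIl.
  by rewrite idx => /setIP[].
have gk k : g ^+ k \in L x0 -> p %| k.
  move=> kL; apply: contraR gL => pk; apply: expg_coprime_mem zL kL _.
  by rewrite prime_coprime.
have LgG : L x0 * <[g]> = G.
  apply/eqP; rewrite eqEcard mul_subG ?LG //=.
  have := mul_cardG <[g]>%G (L x0)%G; rewrite -(Lagrange (subsetIl <[g]> (L x0))) idx.
  rewrite mulnC [(_ * p)%N]mulnC mulnA => /eqP; rewrite eqn_pmul2r ?cardG_gt0 // => /eqP.
  rewrite (cardG x0) mulnC => ->; apply: eq_leq.
  by rewrite -[RHS]card_invg invMg !invGid.
have cover y : exists2 l, l \in L x0 & exists k, y = (g ^+ k) (l x0).
  have : y \in orbit 'P G x0 by rewrite (atransP transG) ?inE.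
  case/orbitP=> h; rewrite -LgG => /mulsgP[l _ lL /cycleP[k ->] ->] <-.
  by exists l => //; exists k; rewrite /= apermE permM.
have zorb y : (g ^+ p) y \in orbit 'P N y.
  have [l lL [k ->]] := cover y; rewrite -permM -expgD addnC expgD permM.
  apply: orbit_im; first exact: groupX.
  have lG := subsetP (LG x0) _ lL.
  have : l x0 \in orbit 'P N x0 by rewrite -memL.
  have : (l * g ^+ p) x0 \in orbit 'P N x0.
    by rewrite -memL; [apply: (@groupM _ ('C_G[x0 | 'P] <*> N)%G) | rewrite groupM ?groupX].
  rewrite permM => H1 H2; apply: orbit_trans H1 _.
  by rewrite orbit_sym.
exists S, g => //; split=> //; last first.
  by exists x0 => k; rewrite -(memL _ (groupX k gG)) => /gk.
apply/permP=> y; rewrite perm1; pose z := g ^+ p; rewrite -/z.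
have pz : p.-elt z by apply: p_eltX.
have sZN : <[z]> \subset 'N(S) by rewrite cycle_subG groupX.
(* The H-orbit of [y] stays in a block, is a union of S-orbits, and has odd size; so it has 5
   points, fewer than [p], and the p-element [z] fixes [y]. *)
pose H := (S <*> <[z]>)%G.
have actH : [acts H, on orbit 'P N y | 'P].
  rewrite join_subG (subset_trans sSN) ?acts_orbit ?subsetT //= cycle_subG.
  apply/astabsP => x; rewrite /= apermE; apply/idP/idP => xO.
    by apply: orbit_trans xO; rewrite orbit_sym; apply: zorb.
  exact: orbit_trans (zorb x) xO.
have le10 : #|orbit 'P H y| <= 10.
  by rewrite -(orbN y) subset_leq_card // (acts_sub_orbit _ actH) orbit_refl.
have dvd5 : 5 %| #|orbit 'P H y|.
  have actS : [acts S, on orbit 'P H y | 'P].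
    by rewrite (subset_trans (joing_subl S <[z]>)) ?acts_orbit ?subsetT.
  rewrite -(acts_sum_card_orbit actS).
  rewrite (eq_bigr (fun=> 5)); first by rewrite sum_nat_const dvdn_mull.
  by move=> _ /imsetP[x _ ->]; apply: orbS.
have oddH : odd #|orbit 'P H y|.
  have [a aE] : {a | #|S| = 5 ^ a}%N by apply: p_natP.
  have [b bE] : {b | #|<[z]>| = p ^ b}%N by apply: p_natP.
  apply: (@dvdn_odd _ (#|S| * #|<[z]>|)).
    rewrite card_orbit mul_cardG -norm_joinEr // dvdn_mulr //.
    exact: dvdn_indexg.
  have p_odd : odd p by case: (even_prime p_pr) => // p2; move: p7; rewrite p2.
  by rewrite oddM aE bE !oddX p_odd !orbT.
have H5 : #|orbit 'P H y| = 5.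
  move: dvd5 oddH le10; move: #|_| => k /dvdnP[m ->].
  by case: m => [|[|[|m]]] //; lia.
have <- : 'P%act y z = z y by [].
apply: p_elt_orbit1 pz _; apply: (@leq_ltn_trans 5); last exact: leq_trans p7.
by rewrite -H5 subset_leq_card // imsetS // joing_subr.
Qed.

End Blocks.

(** * Coordinates *)

Lemma Fp_subK (q : nat) (a b : 'F_q) : prime q -> (a - b)%R + b = a %[mod q].
Proof.
move=> q_pr; rewrite -[in RHS](GRing.subrK b a); apply/esym.
have -> : nat_of_ord ((a - b) + b)%R = ((a - b)%R + b) %% q.
  by transitivity (((a - b)%R + b) %% (Zp_trunc (pdiv q)).+2);
    last congr (_ %% _); rewrite ?Fp_cast.
by rewrite modn_mod.
Qed.

Lemma Fp_eqmod (q : nat) (a b : 'F_q) : prime q -> a = b %[mod q] -> a = b.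
Proof.
move=> q_pr e; apply: val_inj => /=.
have lt (c : 'F_q) : c < q by rewrite -[X in _ < X](Fp_cast q_pr) ltn_ord.
by move: e; rewrite !modn_small.
Qed.

Section Coordinates.
Variables (V : finType) (e : rel V) (p : nat) (N S : {group {perm V}})
  (g : {perm V}) (u w : V).
Hypotheses (p_pr : prime p) (p7 : 7 <= p) (cardV : #|V| = (10 * p)%N)
  (e_sym : symmetric e) (e_irr : irreflexive e) (e_con : connected_graph e).
Hypotheses (NA : N \subset Aut_graph e) (gA : g \in Aut_graph e) (nNg : g \in 'N(N)).
Hypotheses (SN : S \subset N) (S5 : 5.-group S) (gN : g \in 'N(S))
  (orbS : forall y, #|orbit 'P S y| = 5) (gp : g ^+ p = 1)
  (gu : forall k, (g ^+ k) u \in orbit 'P N u -> p %| k)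
  (wN : w \in orbit 'P N u) (wS : w \notin orbit 'P S u).

Let autS h : h \in S -> forall x y, e (h x) (h y) = e x y.
Proof. by move=> hS; apply/Aut_graphP; apply: subsetP hS; apply: subset_trans NA. Qed.

Let autg k x y : e ((g ^+ k) x) ((g ^+ k) y) = e x y.
Proof. by move: x y; apply/Aut_graphP; rewrite groupX. Qed.

Variables (t r : {perm V}).
Hypotheses (tS : t \in S) (tu : t u != u) (rS : r \in S) (rw : r w != w)
  (aligned : forall d, fix_le S u ((g ^+ d) w) -> (g ^+ d * t) w = (r * g ^+ d) w).

Let base (s : bool) := if s then w else u.
Let rot (s : bool) := if s then r else t.

Let rotS s : rot s \in S. Proof. by case: s. Qed.

(** Natural exponents let the powers of [g] and [rot s] add up directly; [vn_congr] passes to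
    residues. *)
Let vn s i x := (rot s ^+ x * g ^+ i) (base s).

Let p_odd : odd p.
Proof. by case: (even_prime p_pr) => // p2; move: p7; rewrite p2. Qed.

Let vn_congr s i i' x x' : i = i' %[mod p] -> x = x' %[mod 5] -> vn s i x = vn s i' x'.
Proof.
move=> ei ex; rewrite /vn -(expg_mod i gp) ei expg_mod //.
rewrite -(expg_mod x (orbits5_exponent S5 orbS (rotS s))) ex.
by rewrite expg_mod ?(orbits5_exponent S5 orbS).
Qed.

(** With different kernels adjacency is constant between the two orbits; with equal kernels [rot s]
    translates both of them by 1. The pair from W to U is left to symmetry, [aligned] being stated
    from [u] to translates of [w]. *)
Let vn_shift s s' i x y : s ==> s' ->
  e (vn s 0 x) (vn s' i (y + x)) = e (base s) (vn s' i y).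
Proof.
move=> les; have vn0 : vn s 0 x = (rot s ^+ x) (base s) by rewrite /vn mulg1.
have conjS k : (rot s' ^+ k) ^ (g ^+ i) \in S by rewrite memJ_norm groupX.
have vnE k : vn s' i k = ((rot s' ^+ k) ^ (g ^+ i)) ((g ^+ i) (base s')).
  by rewrite -permM -conjgC.
have [fix_ss'|nfix] := boolP (fix_le S (base s) ((g ^+ i) (base s'))); last first.
  rewrite vn0 !vnE -[base s in RHS](perm1 (base s)).
  have SA := subset_trans SN NA.
  by rewrite !(edge_const S5 orbS SA nfix) ?groupX.
have com : (g ^+ i * rot s) (base s') = (rot s' * g ^+ i) (base s').
  case: s s' les fix_ss' {vn0 conjS vnE} => [] [] //= _ fixi; last first.
  - by apply: (p_elt_commutes S5 orbS p_odd) => //; rewrite ?groupX // -expgM mulnC expgM gp expg1n.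
  - exact: aligned.
  by apply: (p_elt_commutes S5 orbS p_odd) => //; rewrite ?groupX // -expgM mulnC expgM gp expg1n.
have step k : rot s (vn s' i k) = vn s' i k.+1.
  rewrite vnE -permM (orbits5C S5 orbS (conjS k) (rotS s)) permM -[rot s _]permM com.
  by rewrite -permM -mulgA -conjgC mulgA -expgS.
have -> : vn s' i (y + x) = (rot s ^+ x) (vn s' i y).
  elim: x {vn0} => [|x IH]; first by rewrite addn0 perm1.
  by rewrite addnS -step IH expgSr permM.
by rewrite vn0 autS // groupX.
Qed.

Let v (a : bivertex p) := vn a.1.1 a.1.2 a.2.
Let C s s' d x := e (base s) (v (vtx s' d x)).

Let edge_le s s' i j x y : s ==> s' ->
  e (v (vtx s i x)) (v (vtx s' j y)) = C s s' (j - i)%R (y - x)%R.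
Proof.
move=> les; rewrite /C /v /= -(vn_shift _ x _ les).
rewrite -(vn_congr s' (Fp_subK j i p_pr) (Fp_subK y x isT)).
by rewrite -[RHS](autg i) /vn -!permM -!mulgA -!expgD add0n.
Qed.

Let edge_lt_sym d x : C true false d x = C false true (- d)%R (- x)%R.
Proof.
rewrite -[(- d)%R]GRing.add0r -[(- x)%R]GRing.add0r -edge_le // e_sym /C /v /=.
by rewrite {2}/vn !mul1g perm1.
Qed.

Let edgeE a b : e (v a) (v b) = bicirc C a b.
Proof.
case: a b => [[s i] x] [[s' j] y]; rewrite /bicirc /=.
case: (boolP (s ==> s')) => [les|]; first exact: edge_le.
case: s s' => [] [] // _; rewrite e_sym edge_lt_sym !GRing.opprB.
exact: (@edge_le false true).
Qed.

Let Csym s s' d x : C s s' d x = C s' s (- d)%R (- x)%R.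
Proof.
have base_v s1 : base s1 = v (vtx s1 0%R 0%R) by rewrite /v /vn !mul1g perm1.
by rewrite [LHS]/C base_v e_sym edgeE /bicirc /= !GRing.add0r.
Qed.

Let v_orbit a : v a \in orbit 'P N ((g ^+ a.1.2) u).
Proof.
case: a => [[s i] x]; rewrite /v /vn /=.
have /orbitP[n nN] : base s \in orbit 'P N u by case: s => //; apply: orbit_refl.
rewrite /= apermE => <-; apply/orbitP; exists ((n * rot s ^+ x) ^ (g ^+ i)).
  by rewrite memJ_norm ?groupX // groupM // groupX // (subsetP SN).
by rewrite /= apermE -!permM -conjgC mulgA.
Qed.

Let block_inj (i j : 'F_p) : (g ^+ i) u \in orbit 'P N ((g ^+ j) u) -> i = j.
Proof.
have main (a b : 'F_p) : a <= b -> (g ^+ b) u \in orbit 'P N ((g ^+ a) u) -> a = b.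
  move=> leab /orbitP[n nN]; rewrite /= apermE => nE.
  apply: Fp_eqmod => //; apply/eqP; rewrite eq_sym eqn_mod_dvd //; apply: gu.
  apply/orbitP; exists (g ^+ a * n * (g ^+ a)^-1).
    by rewrite -mulgA -{1}[g ^+ a]invgK memJ_norm // groupV groupX.
  rewrite /= apermE; apply: (@perm_inj _ (g ^+ a)).
  by rewrite -!permM -expgD subnK // mulgKV permM nE.
case: (leqP i j) => [le_ij|/ltnW le_ji] H; last by apply/esym/main.
by apply: main => //; rewrite orbit_sym.
Qed.

Let v_inj : injective v.
Proof.
move=> a b ab; have ij : a.1.2 = b.1.2.
  apply: block_inj; apply: orbit_trans (v_orbit b).
  by rewrite -ab orbit_sym v_orbit.
move: ab; case: a b ij => [[s i] x] [[s' j] y] /= <-; rewrite /v /vn /= !permM => /perm_inj ab.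
have ss : s = s'.
  have absurd k l : (t ^+ k) u = (r ^+ l) w -> False.
    move=> H; case/negP: wS; apply/orbitP; exists (t ^+ k * (r ^+ l)^-1).
      by rewrite groupM ?groupV ?groupX.
    by rewrite /= apermE permM H permK.
  by move: ab; case: (s) (s') => [] [] //= => [/esym|] /absurd.
rewrite ss in ab *; congr (_, _, _).
by apply: Fp_eqmod => //; apply: (orbits5_expg S5 orbS _ _ ab) => //; case: (s').
Qed.

Lemma coordinates_hamiltonian : hamiltonian e.
Proof.
have cardE : #|bivertex p| = #|V| by rewrite card_bivertex.
have v_bij : bijective v by apply: inj_card_bij => //; rewrite cardE.
have [v' vK v'K] := v_bij.
apply: (hamiltonian_bij v_inj cardE edgeE).
(* In coordinates, this element of [N] is the automorphism that fixes every block index and moves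
   [u] to the W side. *)
have /orbitP[n nN] := wN; rewrite /= apermE => nu.
have autn : forall x y, e (n x) (n y) = e x y by apply/Aut_graphP; apply: subsetP nN.
apply: (@bicirc_hamiltonian p p_pr p7 C Csym _ _ (fun a => v' (n (v a)))).
- move=> s; have := e_irr (v (vtx s 0%R 0%R)); rewrite edgeE /bicirc /= !GRing.subrr.
  exact.
- exact: connected_graph_bij v_bij edgeE e_con.
- by apply: inj_comp (can_inj v'K) (inj_comp perm_inj v_inj).
- by move=> a b; rewrite -!edgeE !v'K autn.
- move=> a; apply: block_inj.
  apply: orbit_trans (_ : v (v' (n (v a))) \in _); first by rewrite orbit_sym v_orbit.
  by rewrite v'K; apply: orbit_trans (v_orbit a); apply: mem_orbit.
have -> : n (v (vtx false 0%R 0%R)) = v (vtx true 0%R 0%R) by rewrite /v /vn /= !mul1g !perm1 nu.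
by rewrite vK.
Qed.

End Coordinates.

Theorem theorem5p1 (V : finType) (e : rel V) (p : nat)
  (G N : {group {perm V}}) :
  prime p -> (7 <= p)%N ->
  simple_graph e -> connected_graph e -> vertex_transitive e ->
  #|V| = (10 * p)%N ->
  minimal_transitive e G ->
  N <| G -> N :!=: 1 ->
  (* the N-orbits (which form a complete block system of G) have size 10 *)
  (forall x : V, #|orbit 'P N x| = 10%N) ->
  hamiltonian e.
Proof.
move=> p_pr p7 [e_sym e_irr] e_con _ cardV [GA transG _] nNG _ orbN.
have [S [g [SN S5 gG gN] [orbS gp [u gu]]]] :=
  exists_block_rotation p_pr p7 cardV transG nNG orbN.
(* The block of [u] has 10 points and its S-orbit only 5, so [w] can represent the other side. *)
have /subsetPn[w wN wS] : ~~ (orbit 'P N u \subset orbit 'P S u).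
  by apply/negP => /subset_leq_card; rewrite orbN orbS.
have [t tS tu] := exists_moving orbS u.
have p_odd : odd p by case: (even_prime p_pr) => // p2; move: p7; rewrite p2.
have [r [rS rw aligned]] := exists_aligned S5 orbS w p_odd gN gp tS tu.
apply: (coordinates_hamiltonian p_pr p7 cardV e_sym e_irr e_con _ _ _ SN S5 gN orbS
  gp gu wN wS tS tu rS rw aligned).
- exact: subset_trans (normal_sub nNG) GA.
- exact: subsetP GA _ gG.
- exact: subsetP (normal_norm nNG) _ gG.
Qed.
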